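(* Let $u_0\in\mathfrak g_{-\infty}$ and, for $r\in(1,\infty)$, let $\varphi^r(t,x)$ be the solution of the $r$-Hunter--Saxton equation (in Lagrangian coordinates) with initial conditions $\varphi^r(0,x)=x$ and $\varphi^r_t(0,x)=u_0(x)$. Then we have the pointwise limit $$\lim_{r\to\infty}\varphi^r(t,x)=x+\int_{-\infty}^x\left(e^{t\,u_0'(y)}-1\right)dy=:\varphi^\infty(t,x),$$ which exists for all time $t$. The function $\varphi^\infty(t,\cdot)\in\mathrm{Diff}_{-\infty}(\mathbb R)$ satisfies the differential equation $$\left(\frac{\varphi_{tx}}{\varphi_x}\right)_t=0,$$ which is the formal limit, as $r\to\infty$, of the Lagrangian form of the $r$-Hunter--Saxton equation $$r\,\frac{d}{dt}\left(\frac{\varphi_{tx}}{\varphi_x}\left|\frac{\varphi_{tx}}{\varphi_x}\right|^{r-2}\right)+(r-1)\left|\frac{\varphi_{tx}}{\varphi_x}\right|^r=0.$$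
   Context: $W^{\infty,1}(\mathbb R)=\bigcap_{k\ge 0}W^{k,1}(\mathbb R)$; $\mathrm{Diff}_{-\infty}(\mathbb R)=\{\varphi=\mathrm{id}+f: f'\in W^{\infty,1}(\mathbb R),\ f'>-1,\ \lim_{x\to-\infty}f(x)=0\}$; $\mathfrak g_{-\infty}=\{u: u'\in W^{\infty,1}(\mathbb R),\ \lim_{x\to-\infty}u(x)=0\}$ is its Lie algebra. The solution $\varphi^r$ with the stated initial conditions is given by $$\varphi^r(t,x)=x+\int_{-\infty}^x\left(\left(\frac{t\,u_0'(y)}{r}+1\right)^r-1\right)dy,$$ for as long as it remains in $\mathrm{Diff}_{-\infty}(\mathbb R)$; for each fixed $t$ this is the case for all sufficiently large $r$, and the limit is taken over such $r$. Subscripts $t,x$ denote partial derivatives. *)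

(* Defs.v *)
(* Built on MathComp and MathComp-Analysis. *)
From HB Require Export structures.
From mathcomp Require Export all_boot all_order all_algebra.
From mathcomp Require Export all_classical all_reals all_analysis.

Set Implicit Arguments.
Unset Strict Implicit.
Unset Printing Implicit Defensive.

Export Order.TTheory GRing.Theory Num.Theory.
Export numFieldNormedType.Exports.

Local Open Scope classical_set_scope.
Local Open Scope ring_scope.

(* W^{k,1}(R), on pointwise-defined representatives: for k > 0, f is the
   absolutely continuous representative, that is, an indefinite integral of its
   weak derivative g, and g is again in W^{k-1,1}(R). *)
Fixpoint sobolev1 {R : realType} (k : nat) (f : R -> R) : Prop :=
  (@lebesgue_measure R).-integrable setT (EFin \o f) /\
  match k with
  | 0%N => True
  | k'.+1 => exists2 g : R -> R, sobolev1 k' g &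
      forall a b : R, a <= b ->
        f b - f a = \int[@lebesgue_measure R]_(x in `[a, b]) g x
  end.

Definition sobolev1_infty {R : realType} (f : R -> R) : Prop :=
  forall k : nat, sobolev1 k f.

Definition vanishing_left_infty {R : realType} (f : R -> R) : Prop :=
  f x @[x --> -oo] --> (0 : R).

Definition g_minus_infty {R : realType} (u : R -> R) : Prop :=
  [/\ forall x, derivable u x 1,
      sobolev1_infty (derive1 u) &
      vanishing_left_infty u].

Definition Diff_minus_infty {R : realType} (phi : R -> R) : Prop :=
  exists2 f : R -> R, phi = (fun x => x + f x) &
    [/\ forall x, derivable f x 1,
        sobolev1_infty (derive1 f),
        forall x, derive1 f x > -1 &
        vanishing_left_infty f].

(* Functions of (t, x) are curried, with time as the first argument. *)
Definition dt {R : realType} (phi : R -> R -> R) : R -> R -> R :=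
  fun t x => derive1 (fun s => phi s x) t.

Definition dx {R : realType} (phi : R -> R -> R) : R -> R -> R :=
  fun t x => derive1 (phi t) x.

(* phi_tx / phi_x *)
Definition log_strain_rate {R : realType} (phi : R -> R -> R) : R -> R -> R :=
  fun t x => dx (dt phi) t x / dx phi t x.

(* Existence of phi_t, phi_x and phi_tx on I x R and continuity of phi_tx there.
   By Schwarz's theorem phi_xt then exists and equals phi_tx. *)
Definition regular_path {R : realType} (I : set R) (phi : R -> R -> R) : Prop :=
  forall t x : R, I t ->
    [/\ derivable (fun s => phi s x) t 1,
        derivable (phi t) x 1,
        derivable (dt phi t) x 1 &
        {for (t, x), continuous (fun p : R * R => dx (dt phi) p.1 p.2)}].

(* w |w|^(r-2), extended by 0 at w = 0 when r < 2. *)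
Definition hs_momentum {R : realType} (r w : R) : R := w * `|w| `^ (r - 2).

(* Left-hand side of the Lagrangian r-Hunter--Saxton equation. *)
Definition hs_lhs {R : realType} (r : R) (phi : R -> R -> R) (t x : R) : R :=
  r * dt (fun s y => hs_momentum r (log_strain_rate phi s y)) t x +
  (r - 1) * `|log_strain_rate phi t x| `^ r.

(* Classical solution in Diff_{-oo}(R) on the open time interval I containing 0,
   with phi(0, .) = id and phi_t(0, .) = u0. *)
Definition hs_solution {R : realType} (r : R) (u0 : R -> R) (I : set R)
    (phi : R -> R -> R) : Prop :=
  [/\ [/\ is_interval I, open I & I 0],
      forall t, I t -> Diff_minus_infty (phi t),
      regular_path I phi,
      (forall x, phi 0 x = x) /\ (forall x, dt phi 0 x = u0 x) &
      forall t x, I t ->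
        derivable (fun s => hs_momentum r (log_strain_rate phi s x)) t 1 /\
        hs_lhs r phi t x = 0].

(* The maximal existence interval: the union of the intervals on which some
   solution exists. *)
Definition hs_lifespan {R : realType} (r : R) (u0 : R -> R) : set R :=
  [set t | exists J psi, hs_solution r u0 J psi /\ J t].

Definition phi_infty {R : realType} (u0 : R -> R) (t x : R) : R :=
  x + \int[@lebesgue_measure R]_(y in `]-oo, x]) (expR (t * derive1 u0 y) - 1).

(* Main.v *)
(* With v = u0', the r-equation conserves phi_x^((r-1)/r) w |w|^(r-2), where
   w = phi_tx / phi_x, whence phi_x^(1/r) is affine in time and
   phi_x = (1 + t v / r)^r. Conversely this formula defines a solution as long as
   |t| sup |v| <= r / 2, so the lifespan exhausts R as r -> oo, and since
   |(1 + z/r)^r - e^z| <= 2 e^z z^2 / r there, the integrals converge at rate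
   O(1/r) with the integrable bound |v|. *)
Require Import Defs.
From mathcomp Require Import ring lra measurable_realfun.

Set Implicit Arguments.
Unset Strict Implicit.
Unset Printing Implicit Defensive.

Local Open Scope classical_set_scope.
Local Open Scope ring_scope.

(** The hypothesis speaks of an arbitrary classical solution on its whole lifespan, so the explicit
    formula must be shown necessary, for every solution on every interval, and sufficient, on an
    interval growing with r. Two points make necessity delicate. The regularity of a solution
    provides (phi_t)_x, whereas the conservation law differentiates phi_x in time; so the symmetry
    of the mixed derivative is derived from the continuity of phi_tx. And what is known to be
    differentiable in time is w |w|^(r-2), not w, which may vanish; so the conserved quantity is
    differentiated through the momentum itself, and w is recovered afterwards by injectivity of w ->
    w |w|^(r-2). The fraction 1/2 keeps 1 + t v / r within [1/2, 3/2], away from the singularity of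
    powers at 0: powers of either sign then differ from 1 by at most a multiple of |v|, which yields
    integrability. Membership in W^{oo,1} is handled by replacing the tower of weak derivatives by
    classical ones, to which product and chain rules apply. *)

Lemma is_derive_derive1 (R : realType) (f : R -> R) (x d : R) :
  is_derive x 1 f d -> derive1 f x = d.
Proof. by move=> fd; rewrite derive1E derive_val. Qed.

Lemma derivable_is_derive1 (R : realType) (f : R -> R) (x : R) :
  derivable f x 1 -> is_derive x 1 f (derive1 f x).
Proof. by move=> fx; rewrite derive1E; apply: DeriveDef. Qed.

Lemma is_derive_continuous (R : realType) (f : R -> R) (x d : R) :
  is_derive x 1 f d -> {for x, continuous f}.
Proof.
by move=> fd; apply/differentiable_continuous/derivable1_diffP; exact: ex_derive.
Qed.

Lemma integrable_le_norm (R : realType) (f g : R -> R) (C : R) :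
  continuous f -> (forall x, `|f x| <= C * `|g x|) ->
  (@lebesgue_measure R).-integrable setT (EFin \o g) ->
  (@lebesgue_measure R).-integrable setT (EFin \o f).
Proof.
move=> cf fg ig.
have : (@lebesgue_measure R).-integrable setT (EFin \o (fun x => C * g x)).
  rewrite (_ : _ \o _ = fun x => C%:E * (EFin \o g) x)%E; first exact: integrableZl.
  by apply/funext => x /=; rewrite EFinM.
apply: le_integrable => //.
  apply/measurable_EFinP; exact: continuous_measurable_fun.
move=> x _ /=; rewrite lee_fin (le_trans (fg x))// normrM ler_wpM2r//.
exact: ler_norm.
Qed.

(** * Indefinite integrals of integrable functions on the line *)

Section indefinite_integral.
Context {R : realType}.
Notation mu := (@lebesgue_measure R).
Variables f g : R -> R.
Hypothesis ig : mu.-integrable setT (EFin \o g).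
Hypothesis fg : forall a b : R, a <= b -> f b - f a = \int[mu]_(x in `[a, b]) g x.

Let igS (A : set R) : measurable A -> mu.-integrable A (EFin \o g).
Proof. by move=> mA; apply: integrableS ig. Qed.

Lemma indefinite_integral_continuous : continuous f.
Proof.
move=> x.
have h : {in `]x - 1, x + 1[, continuous
    (fun y => f (x - 1) + parameterized_integral mu (x - 1) y g)}.
  have ab : x - 1 < x + 1 by lra.
  have := @parameterized_integral_continuous R (x - 1) (x + 1) g (ltW ab)
    (igS (measurable_itv _)).
  move/(continuous_within_itvP _ ab) => [+ _ _] y yI => /(_ y yI) cy.
  by apply: cvgD; [exact: cvg_cst|exact: cy].
have xI : x \in `]x - 1, x + 1[%R by rewrite in_itv/=; lra.
have E : \forall y \near x, f (x - 1) + parameterized_integral mu (x - 1) y g = f y.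
  apply: filterS (near_in_itvoo xI) => y; rewrite in_itv/= => /andP[xy _].
  by rewrite /parameterized_integral -fg ?(ltW xy)// subrKC.
rewrite /continuous_at -(nbhs_singleton E); apply: cvg_trans (h x xI).
exact: near_eq_cvg E.
Qed.

(** Every increment of [f] is at most the L^1 norm of [g]. This embedding of W^{1,1} into the
    bounded functions is the source of the bound sup |v| < oo. *)
Lemma indefinite_integral_bounded : exists M, forall x, `|f x| <= M.
Proof.
exists (`|f 0| + \int[mu]_x `|g x|) => x.
have ign : mu.-integrable setT (EFin \o (fun x => `|g x|)).
  exact: (integrable_norm ig).
have B a b : a <= b -> `|f b - f a| <= \int[mu]_x `|g x|.
  move=> ab; rewrite fg//.
  apply: le_trans (le_normr_Rintegral _ _) _ => //; first exact: igS.
  apply: fine_le.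
  - by apply: integrable_fin_num => //; apply: integrableS ign.
  - exact: integrable_fin_num.
  - apply: ge0_subset_integral => //.
    by have /integrableP[] := ign.
have [x0|x0] := leP 0 x.
  by have := B _ _ x0; have := ler_normD (f 0) (f x - f 0); rewrite [_ + (_ - _)]addrC subrK; lra.
by have := B _ _ (ltW x0); have := ler_normB (f 0) (f 0 - f x); rewrite opprB addrC subrK; lra.
Qed.

Lemma indefinite_integral_is_derive x : {for x, continuous g} -> is_derive x 1 f (g x).
Proof.
move=> cg.
have xx : x < x + 1 by lra.
have [d e] := @continuous_FTC1_closed R g (x - 1) x (x + 1) xx
  (igS (measurable_itv _)) ltac:(lra) cg.
apply: (@near_eq_is_derive _ _ _
   (fun y => f (x - 1) + \int[mu]_(t in `[x - 1, y]) g t)).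
  have xI : x \in `]x - 1, x + 1[%R by rewrite in_itv/=; lra.
  apply: filterS (near_in_itvoo xI) => y; rewrite in_itv/= => /andP[xy _].
  by rewrite -fg ?(ltW xy)// subrKC.
rewrite -[g x]add0r; apply: is_deriveD.
by rewrite -e; exact: derivable_is_derive1.
Qed.

End indefinite_integral.

(** * Classical W^{k,1} functions *)

(** Boundedness is recorded at each level because it makes the class an algebra: a bounded function
    times an integrable one is integrable. Functions in W^{oo,1} belong to it at every level, see
    [sobolev1_infty_csobolev1]. *)
Fixpoint csobolev1 {R : realType} (k : nat) (f : R -> R) : Prop :=
  [/\ (@lebesgue_measure R).-integrable setT (EFin \o f), continuous f &
      exists M, forall x, `|f x| <= M] /\
  match k with
  | 0%N => True
  | k'.+1 => (forall x, derivable f x 1) /\ csobolev1 k' (derive1 f)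
  end.

Section csobolev1.
Context {R : realType}.
Notation mu := (@lebesgue_measure R).
Implicit Types (f g h w : R -> R) (k : nat).

Lemma csobolev1_0 k f : csobolev1 k f ->
  [/\ mu.-integrable setT (EFin \o f), continuous f & exists M, forall x, `|f x| <= M].
Proof. by case: k => [|k] []. Qed.

Lemma csobolev1W k f : csobolev1 k.+1 f -> csobolev1 k f.
Proof.
elim: k f => [|k IH] f [f0 [df f1]]; split => //.
by split => //; exact: IH.
Qed.

Lemma csobolev1D k f g : csobolev1 k f -> csobolev1 k g ->
  csobolev1 k (fun x => f x + g x).
Proof.
elim: k f g => [|k IH] f g [[intf cf [Mf bf]] f1] [[intg cg [Mg bg]] g1].
all: split; [split|].
all: try by move=> x; apply: cvgD; [exact: cf|exact: cg].
all: try by exists (Mf + Mg) => x; rewrite (le_trans (ler_normD _ _))// lerD.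
all: try by have := integrableD measurableT intf intg; apply: eq_integrable.
- by [].
- case: f1 g1 => df f1 [dg g1]; split; first by move=> x; exact: derivableD.
  rewrite (_ : derive1 _ = fun x => derive1 f x + derive1 g x); first exact: IH.
  apply/funext => x; apply: is_derive_derive1.
  by apply: is_deriveD; exact: derivable_is_derive1.
Qed.

Lemma csobolev1Zl k (c : R) f :
  csobolev1 k f -> csobolev1 k (fun x => c * f x).
Proof.
elim: k f => [|k IH] f [[intf cf [Mf bf]] f1].
all: split; [split|] => //.
all: try by move=> x; apply: cvgM; [exact: cvg_cst|exact: cf].
all: try by exists (`|c| * Mf) => x; rewrite normrM ler_wpM2l.
all: try by have := integrableZl measurableT c intf; apply: eq_integrable.
case: f1 => df f1; split; first by move=> x; exact: derivableM.
rewrite (_ : derive1 _ = fun x => c * derive1 f x); first exact: IH.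
apply/funext => x; apply: is_derive_derive1.
by apply: is_deriveZ; exact: derivable_is_derive1.
Qed.

Lemma csobolev1M k f g : csobolev1 k f -> csobolev1 k g ->
  csobolev1 k (fun x => f x * g x).
Proof.
elim: k f g => [|k IH] f g fS gS.
all: move: (fS) (gS) => [[intf cf [Mf bf]] f1] [[intg cg [Mg bg]] g1].
all: have cfg : continuous (fun x => f x * g x)
  by move=> x; apply: cvgM; [exact: cf|exact: cg].
all: split; [split|] => //.
all: try by exists (Mf * Mg) => x; rewrite normrM ler_pM.
all: try by apply: (@integrable_le_norm _ _ g Mf) => // x; rewrite normrM ler_wpM2r.
case: f1 g1 => df f1 [dg g1]; split; first by move=> x; exact: derivableM.
rewrite (_ : derive1 _ = fun x => f x * derive1 g x + g x * derive1 f x).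
  by apply: csobolev1D; apply: IH => //; exact: csobolev1W.
apply/funext => x; apply: is_derive_derive1.
by apply: is_deriveM; exact: derivable_is_derive1.
Qed.

(* The hypothesis is self-reproducing: differentiating a member of the family
   Q yields members of Q again, multiplied by smooth factors. *)
Lemma csobolev1_family (Q : (R -> R) -> Prop) :
  (forall h, Q h -> csobolev1 0 h) ->
  (forall h, Q h -> exists w h2, [/\ forall k, csobolev1 k w, Q h2 &
     forall x : R, is_derive x 1 h (w x * h2 x + w x)]) ->
  forall k h, Q h -> csobolev1 k h.
Proof.
move=> Q0 Q1; elim=> [|k IH] h Qh; first exact: Q0.
have [w [h2 [wS Qh2 dh]]] := Q1 _ Qh.
have dhE : derive1 h = fun x => w x * h2 x + w x.
  by apply/funext => x; exact: is_derive_derive1.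
split; first exact: csobolev1_0 (Q0 _ Qh).
split=> [x|]; first by have [] := dh x.
by rewrite dhE; apply: csobolev1D => //; apply: csobolev1M => //; exact: IH.
Qed.

Lemma csobolev1_sobolev1 k f : csobolev1 k f -> sobolev1 k f.
Proof.
elim: k f => [|k IH] f [[intf cf bf] f1]; split => //.
case: f1 => df f1; exists (derive1 f); first exact: IH.
move=> a b; rewrite le_eqVlt => /predU1P[->|ab].
  by rewrite subrr set_itv1 Rintegral_set1.
have [_ cdf _] := csobolev1_0 f1.
rewrite /Rintegral (@continuous_FTC2 _ _ f)//.
- exact: continuous_subspaceT.
- split => //.
  + exact/cvg_at_right_filter/cf.
  + exact/cvg_at_left_filter/cf.
Qed.

Lemma sobolev1_0 k f : sobolev1 k f -> mu.-integrable setT (EFin \o f).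
Proof. by case: k => [|k] []. Qed.

Lemma sobolev1W k f : sobolev1 k.+1 f -> sobolev1 k f.
Proof.
elim: k f => [|k IH] f [f0 [g gS fg]]; split => //.
by exists g => //; exact: IH.
Qed.

(** The weak derivatives supplied for different k are a priori unrelated. Taken two levels up, each
    is itself an indefinite integral, hence continuous, hence equal everywhere to the classical
    derivative; this glues the choices into the single function [derive1 f]. *)
Lemma sobolev1_infty_derivable f : sobolev1_infty f ->
  (forall x, derivable f x 1) /\ sobolev1_infty (derive1 f).
Proof.
move=> fS.
have D k : exists2 g : R -> R, sobolev1 k g & forall x : R, is_derive x 1 f (g x).
  have [_ [g gS fg]] := fS k.+2; have [ig [g' /sobolev1_0 ig' gg']] := gS.
  have cg : continuous g by exact: (@indefinite_integral_continuous _ g g').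
  exists g => [|x]; first exact: sobolev1W.
  by apply: (indefinite_integral_is_derive ig fg); exact: cg.
split => [x|k]; first by have [g _ fg] := D 0%N; have [] := fg x.
have [g gS fg] := D k.
by rewrite (_ : derive1 f = g)//; apply/funext => x; apply: is_derive_derive1.
Qed.

Lemma sobolev1_infty_csobolev1 k f : sobolev1_infty f -> csobolev1 k f.
Proof.
elim: k f => [|k IH] f fS; split => //.
all: try by have [intf [g [ig _] fg]] := fS 1%N;
  split => //; [exact: (@indefinite_integral_continuous _ f g)|
                exact: (@indefinite_integral_bounded _ f g)].
by have [df dfS] := sobolev1_infty_derivable fS; split => //; exact: IH.
Qed.

End csobolev1.

(** * Compositions of v with exp and powers *)

Section exp_estimates.
Context {R : realType}.
Implicit Types (a b c r s x y z : R) (f g : R -> R).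

Lemma is_derive_expR_comp g x b : is_derive x 1 g b ->
  is_derive x 1 (fun y => expR (g y)) (expR (g x) * b).
Proof.
by move=> dg; apply: (@is_derive1_comp _ expR g x (expR (g x)) b).
Qed.

Lemma is_derive_powR_comp g s x b : 0 < g x -> is_derive x 1 g b ->
  is_derive x 1 (fun y => g y `^ s) (s * g x `^ (s - 1) * b).
Proof.
move=> g0 dg; apply: (@is_derive1_comp _ (fun y => y `^ s) g x _ b) => //.
have gI : g x \in `]0, +oo[%R by rewrite in_itv/= g0.
apply: DeriveDef; first exact: derivable_powR.
by rewrite -derive1E powR_derive1.
Qed.

Lemma normr_expRB1 a : `|expR a - 1| <= `|a| * expR `|a|.
Proof.
have [a0|a0] := leP 0 a.
  rewrite [X in _ <= _ * expR X]ger0_norm// (ger0_norm a0).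
  rewrite ger0_norm ?subr_ge0 -?expR0 ?ler_expR//.
  have := expR_ge1Dx (- a); rewrite -(ler_pM2l (expR_gt0 a)) -expRD subrr expR0.
  by lra.
have e1 : expR a < 1 by rewrite expR_lt1.
rewrite ltr0_norm ?subr_lt0// (ltr0_norm a0).
have := expR_ge1Dx a; have := expR_ge1Dx (- a); have := expR_ge0 (- a).
by nra.
Qed.

(** This is ln (1 + x) <= x at x = (1 + y)^-1 - 1. *)
Lemma ler_ln1D y : -1 < y -> y / (1 + y) <= ln (1 + y).
Proof.
move=> y1; have y0 : 0 < 1 + y by lra.
have := @le_ln1Dx R ((1 + y)^-1 - 1).
rewrite ltrBrDl subrr invr_gt0 => /(_ y0).
rewrite addrC subrK lnV ?posrE// => h.
rewrite (_ : y / (1 + y) = 1 - (1 + y)^-1); first by lra.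
by field; rewrite gt_eqF.
Qed.

Lemma normr_ln1D y : `|y| <= 2^-1 -> `|ln (1 + y)| <= 2 * `|y|.
Proof.
move=> yh; have /andP[y1 y2] : - 2^-1 <= y <= 2^-1 by rewrite -ler_norml.
have h1 := @ler_ln1D y ltac:(lra); have h2 := @le_ln1Dx R y ltac:(lra).
rewrite ler_norml; apply/andP; split; last first.
  by apply: (le_trans h2); have := ler_norm y; have := normr_ge0 y; lra.
apply: le_trans h1; rewrite ler_pdivlMr; last by lra.
have [y0|y0] := leP 0 y; first by rewrite ger0_norm//; nra.
by rewrite ltr0_norm//; nra.
Qed.

(* Compared with e^z, the power (1 + z/r)^r loses the factor e^(-d) with
   d = z - r ln (1 + z/r) between 0 and 2 z^2 / r. *)
Lemma powR_1Dr_expR r z : 0 < r -> `|z| <= r / 2 ->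
  `|(1 + z / r) `^ r - expR z| <= expR z * (2 * z ^+ 2 / r).
Proof.
move=> r0 zr.
have : `|z / r| <= 2^-1.
  by rewrite normf_div (gtr0_norm r0) ler_pdivrMr// mulrC.
rewrite ler_norml => /andP[y1 y2].
have yz : z = r * (z / r) by field; rewrite gt_eqF.
set y := z / r in y1 y2 yz *.
have h1 := @ler_ln1D y ltac:(lra); have h2 := @le_ln1Dx R y ltac:(lra).
rewrite /powR gt_eqF; last by lra.
set d := z - r * ln (1 + y).
have d0 : 0 <= d by rewrite /d subr_ge0 yz ler_pM2l.
(* y - ln (1 + y) <= y - y / (1 + y) = y^2 / (1 + y) <= 2 y^2, since y >= -1/2. *)
have d1 : d <= 2 * z ^+ 2 / r.
  rewrite (_ : 2 * z ^+ 2 / r = r * (2 * y ^+ 2)); last first.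
    by rewrite /y; field; rewrite gt_eqF.
  rewrite /d {1}yz -mulrBr ler_pM2l// lerBlDr -lerBlDl.
  apply: le_trans h1; rewrite ler_pdivlMr; last by lra.
  by nra.
rewrite (_ : r * ln (1 + y) = z - d); last by rewrite /d; ring.
rewrite expRD ler0_norm.
  have := expR_ge1Dx (- d); have := expR_gt0 z; nra.
by rewrite subr_le0 ler_piMr ?expR_ge0// expR_le1; lra.
Qed.

End exp_estimates.

Section densities.
Context {R : realType}.
Variables (v : R -> R) (M : R).
Hypotheses (vS : forall k, csobolev1 k v) (vM : forall x, `|v x| <= M).

Let iv : (@lebesgue_measure R).-integrable setT (EFin \o v).
Proof. by have [] := csobolev1_0 (vS 0). Qed.

Let dv (x : R) : is_derive x 1 v (derive1 v x).
Proof. by have [_ [dv _]] := vS 1; exact: derivable_is_derive1. Qed.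

Let dvS k : csobolev1 k (derive1 v).
Proof. by have [_ []] := vS k.+1. Qed.

Lemma csobolev1_le_norm (f : R -> R) (C : R) :
  continuous f -> (forall x, `|f x| <= C * `|v x|) -> csobolev1 0 f.
Proof.
move=> cf fv; split => //; split => //; first exact: integrable_le_norm fv iv.
exists (`|C| * M) => x; rewrite (le_trans (fv x))//.
by rewrite (@le_trans _ _ (`|C| * `|v x|)) ?ler_wpM2l// ler_wpM2r// ler_norm.
Qed.

(** With h = e^(tv) - 1 one has h' = t v' h + t v', so the singleton {h} is already closed under
    differentiation in the sense of [csobolev1_family]. *)
Lemma csobolev1_exp k (t : R) : csobolev1 k (fun x => expR (t * v x) - 1).
Proof.
have D (x : R) : is_derive x 1 (fun x => expR (t * v x) - 1)
    (t * derive1 v x * (expR (t * v x) - 1) + t * derive1 v x).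
  rewrite (_ : _ + _ = expR (t * v x) * (t * derive1 v x) - 0); last by ring.
  apply: is_deriveB; apply: is_derive_expR_comp.
  by apply: is_deriveZ.
apply: (@csobolev1_family _ (fun h => h = fun x => expR (t * v x) - 1)) => //.
  move=> _ ->; apply: (@csobolev1_le_norm _ (`|t| * expR (`|t| * M))).
    by move=> x; exact: is_derive_continuous (D x).
  move=> x; rewrite (le_trans (normr_expRB1 _))// normrM mulrAC.
  by rewrite ler_wpM2r// ler_wpM2l// ler_expR ler_wpM2l.
move=> _ ->; exists (fun x => t * derive1 v x), (fun x => expR (t * v x) - 1).
by split => // j; exact: csobolev1Zl.
Qed.

Lemma base_bounds (c x : R) : `|c| * M <= 2^-1 -> `|c * v x| <= 2^-1.
Proof. by move=> cM; rewrite normrM (le_trans _ cM)// ler_wpM2l. Qed.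

Lemma base_gt0 (c x : R) : `|c| * M <= 2^-1 -> 0 < 1 + c * v x.
Proof. by move/(base_bounds x); rewrite ler_norml => /andP[]; lra. Qed.

(** Differentiation lowers the exponent by 1, so the family must run over all real exponents a,
    negative ones included. The domination by |v| comes from writing the power as e^b with b = a ln
    (1 + c v), where |ln (1 + c v)| <= 2 |c v| <= 1. *)
Lemma csobolev1_powR k (c s : R) : `|c| * M <= 2^-1 ->
  csobolev1 k (fun x => (1 + c * v x) `^ s - 1).
Proof.
move=> cM.
have D a (x : R) : is_derive x 1 (fun x => (1 + c * v x) `^ a - 1)
    (a * c * derive1 v x * ((1 + c * v x) `^ (a - 1) - 1) + a * c * derive1 v x).
  rewrite (_ : _ + _ = a * (1 + c * v x) `^ (a - 1) * (c * derive1 v x) - 0);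
    last by ring.
  apply: is_deriveB; apply: is_derive_powR_comp; first exact: base_gt0.
  by rewrite -[c * _]add0r; apply: is_deriveD; apply: is_deriveZ.
apply: (@csobolev1_family _ (fun h => exists a, h = fun x => (1 + c * v x) `^ a - 1)).
- move=> _ [a ->].
  apply: (@csobolev1_le_norm _ (`|a| * (2 * `|c|) * expR (`|a| * (2 * 2^-1)))).
    by move=> x; exact: is_derive_continuous (D a x).
  move=> x; rewrite /powR gt_eqF ?base_gt0//.
  rewrite (le_trans (normr_expRB1 _))// normrM [leRHS]mulrAC.
  have h := normr_ln1D (base_bounds x cM).
  apply: ler_pM => //.
  + by rewrite -!mulrA ler_wpM2l// -normrM.
  + rewrite ler_expR ler_wpM2l// (le_trans h)// ler_wpM2l//; exact: base_bounds.
- move=> _ [a ->]; exists (fun x => a * c * derive1 v x).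
  exists (fun x => (1 + c * v x) `^ (a - 1) - 1).
  by split => [j||//]; [exact: csobolev1Zl|exists (a - 1)].
- by exists s.
Qed.

End densities.

(** * Flows with prescribed spatial derivative *)

Section primitive.
Context {R : realType}.
Notation mu := (@lebesgue_measure R).
Variable f : R -> R.
Hypothesis intf : mu.-integrable setT (EFin \o f).

(** Dominated convergence along any sequence u n -> -oo: the restrictions of [f] to ]-oo, u n] are
    eventually 0 at each point and bounded by |f|. *)
Lemma integral_itvNy_vanishing :
  vanishing_left_infty (fun x => \int[mu]_(y in `]-oo, x]) f y).
Proof.
apply/cvg_ninftyP => u uNy; apply: fine_cvg.
rewrite [X in _ --> X](_ : _ = \int[mu]_y cst 0%E y)%E; last by rewrite integral0.
under eq_fun do rewrite integral_mkcond.
apply: (@dominated_cvg _ _ _ mu setT measurableT _ (cst 0%E) (fun y => `|(f y)%:E|)%E).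
- move=> n; apply/(measurable_restrictT _ _).1 => //.
  by apply: measurable_funS (measurable_int _ intf).
- move=> y _; apply: cvg_near_cst.
  have /cvgrNyPlt/(_ y) := uNy; apply: filterS => n un.
  by rewrite patchE memNset//= in_itv/=; apply/negP; rewrite -ltNge.
- by [].
- exact: integrable_abse.
- move=> n y _; rewrite patchE; case: ifP => _ //=.
  by rewrite normr0 lee_fin.
Qed.

Lemma is_derive_integral_itvNy (x : R) : {for x, continuous f} ->
  is_derive x 1 (fun z => \int[mu]_(y in `]-oo, z]) f y) (f x).
Proof.
move=> cf; have xx : x < x + 1 by lra.
have ifx : mu.-integrable `]-oo, x + 1] (EFin \o f) by apply: integrableS intf.
have [d <-] := continuous_FTC1 xx ifx (ltNyr x) cf.
exact: derivable_is_derive1.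
Qed.

End primitive.

(** Both [phi_infty u0] and the solution of the r-equation have this form, with phi_x = 1 + g, so
    their regularity is established once for both. *)
Definition flow {R : realType} (g : R -> R -> R) (t x : R) : R :=
  x + \int[@lebesgue_measure R]_(y in `]-oo, x]) g t y.

Section flow.
Context {R : realType}.
Notation mu := (@lebesgue_measure R).

Lemma flow_Diff (g : R -> R -> R) (t : R) :
  (forall k, csobolev1 k (g t)) -> (forall x, g t x > -1) ->
  Diff_minus_infty (flow g t).
Proof.
move=> gS g1; have [intg cg _] := csobolev1_0 (gS 0).
have D x := is_derive_integral_itvNy intg (cg x).
have dE : derive1 (fun z => \int[mu]_(y in `]-oo, z]) g t y) = g t.
  by apply/funext => x; exact: is_derive_derive1.
exists (fun z => \int[mu]_(y in `]-oo, z]) g t y) => //; split.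
- by move=> x; have [] := D x.
- by rewrite dE => k; exact: csobolev1_sobolev1.
- by rewrite dE.
- exact: integral_itvNy_vanishing.
Qed.

Variables (g h : R -> R -> R) (G : R -> R) (rho : R).
Hypothesis intg : forall t, `|t| < rho -> mu.-integrable setT (EFin \o g t).
Hypothesis cg : forall t, `|t| < rho -> continuous (g t).
Hypothesis gh : forall t x : R, `|t| < rho -> is_derive t 1 (g ^~ x) (h t x).
Hypothesis hG : forall t x, `|t| < rho -> `|h t x| <= G x.
Hypothesis intG : mu.-integrable setT (EFin \o G).
Hypothesis ch : forall t x : R, `|t| < rho ->
  {for (t, x), continuous (fun p : R * R => h p.1 p.2)}.

Let chx t x : `|t| < rho -> {for x, continuous (h t)}.
Proof.
move=> tr; have tx : (t, y) @[y --> x] --> (t, x).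
  exact: (cvg_pair (cvg_cst t) cvg_id).
exact: (cvg_comp _ _ tx (ch tr)).
Qed.

Let inth t : `|t| < rho -> mu.-integrable setT (EFin \o h t).
Proof.
move=> tr; apply: (@integrable_le_norm _ _ G 1) => //.
  by move=> x; exact: chx.
by move=> x; rewrite mul1r (le_trans (hG _ tr))// ler_norm.
Qed.

Lemma is_derive_flow_x t (x : R) : `|t| < rho ->
  is_derive x 1 (flow g t) (1 + g t x).
Proof.
move=> tr; apply: is_deriveD.
exact (is_derive_integral_itvNy (intg tr) (@cg t tr x)).
Qed.

(** Differentiation under the integral sign: on |t| < rho the time derivative [h] of [g] is
    dominated by the integrable [G], uniformly in t. *)
Lemma is_derive_flow_t (t : R) x : `|t| < rho ->
  is_derive t 1 (fun s => flow g s x) (\int[mu]_(y in `]-oo, x]) h t y).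
Proof.
move=> tr; rewrite -[X in is_derive _ _ _ X]add0r; apply: is_deriveD.
have I s : `](- rho), rho[%classic (s : R) -> `|s| < rho.
  by rewrite /= in_itv/= ltr_norml.
have tI : `](- rho), rho[%classic (t : R) by rewrite /= in_itv/= -ltr_norml.
have G0 y : 0 <= G y by rewrite (le_trans _ (hG y tr)).
have dh s y : `|s| < rho -> partial1of2 g s y = h s y.
  by move=> sr; exact: is_derive_derive1 (gh _ sr).
have H1 s : `](- rho), rho[%classic s -> mu.-integrable `]-oo, x] (EFin \o g s).
  by move=> /I sr; apply: integrableS (intg sr).
have H2 s y : `](- rho), rho[%classic s -> `]-oo, x]%classic y -> derivable (g ^~ y) s 1.
  by move=> /I sr _; have [] := gh y sr.
have H3 s y : `](- rho), rho[%classic s -> `]-oo, x]%classic y ->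
    `|partial1of2 g s y| <= G y.
  by move=> /I sr _; rewrite dh// hG.
have intGx : mu.-integrable `]-oo, x] (EFin \o G) by apply: integrableS intG.
have E :=
  @differentiation_under_integral _ _ _ mu _ _ (measurable_itv _) _ _ _ tI H1 H2 G G0 intGx H3.
have D :=
  @derivable_under_integral _ _ _ mu _ _ (measurable_itv _) _ _ _ tI H1 H2 G G0 intGx H3.
have := derivable_is_derive1 D; rewrite E; congr is_derive.
by apply: eq_Rintegral => y _; exact: dh.
Qed.

Lemma dt_flow t : `|t| < rho ->
  dt (flow g) t = fun x => \int[mu]_(y in `]-oo, x]) h t y.
Proof. by move=> tr; apply/funext => x; exact: is_derive_derive1 (is_derive_flow_t _ tr). Qed.

Lemma is_derive_dt_flow t (x : R) : `|t| < rho -> is_derive x 1 (dt (flow g) t) (h t x).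
Proof.
by move=> tr; rewrite dt_flow//; exact (is_derive_integral_itvNy (inth tr) (chx tr)).
Qed.

Lemma log_strain_rate_flow t x : `|t| < rho ->
  log_strain_rate (flow g) t x = h t x / (1 + g t x).
Proof.
move=> tr; rewrite /log_strain_rate /dx.
rewrite (is_derive_derive1 (is_derive_dt_flow x tr)).
by rewrite (is_derive_derive1 (is_derive_flow_x x tr)).
Qed.

Lemma flow_regular : regular_path [set t | `|t| < rho] (flow g).
Proof.
move=> t x tr; split.
- by have [] := is_derive_flow_t x tr.
- by have [] := is_derive_flow_x x tr.
- by have [] := is_derive_dt_flow x tr.
- have E : \forall p \near (t, x), h p.1 p.2 = dx (dt (flow g)) p.1 p.2.
    have c : `|p.1| @[p --> (t, x)] --> `|t| by apply: cvg_norm; exact: cvg_fst.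
    apply: filterS (cvgr_lt _ c _ tr) => -[s y] /= sr.
    by rewrite /dx (is_derive_derive1 (is_derive_dt_flow y sr)).
  rewrite /prop_for /continuous_at -(nbhs_singleton E).
  by apply: cvg_trans (ch tr); exact: near_eq_cvg.
Qed.

End flow.

(** * Mixed derivatives *)

Section calculus.
Context {R : realType}.
Implicit Types (f w : R -> R) (I : set R).

Lemma is_derive_cvg f (x d : R) :
  h^-1 *: (f (h + x) - f x) @[h --> 0^'] --> d -> is_derive x 1 f d.
Proof.
move=> fd; have fd' : h^-1 *: ((f \o shift x) (h *: 1) - f x) @[h --> 0^'] --> d.
  by under eq_fun do rewrite /= [_ *: 1]mulr1.
by apply: DeriveDef; [apply/cvg_ex; exists d|exact: cvg_lim].
Qed.

Lemma is_derive_mull (c x : R) : is_derive x 1 ( *%R c) c.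
Proof. by rewrite -[X in is_derive _ _ _ X]mulr1; exact: is_deriveZ. Qed.

Lemma cvg_is_derive f (x d : R) : is_derive x 1 f d ->
  h^-1 *: (f (h + x) - f x) @[h --> 0^'] --> d.
Proof.
move=> [/cvg_ex[l fl] <-]; rewrite /derive (cvg_lim _ fl)//.
by move: fl; under eq_fun do rewrite /= [_ *: 1]mulr1.
Qed.

Lemma is_derive_norm_le f (x d C : R) : is_derive x 1 f d ->
  (\forall y \near x, `|f y - f x| <= C * `|y - x|) -> `|d| <= C.
Proof.
move=> fd /nbhs_ballP[e /= e0 fC].
apply: (cvgr_to_le (cvg_norm (cvg_is_derive fd))).
exists e => //= h; rewrite /ball_/= sub0r normrN => he h0.
rewrite normrM normfV ler_pdivrMl ?normr_gt0// mulrC.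
rewrite -[X in _ * `|X|](addrK x) fC//.
by rewrite /ball/= opprD addrCA subrr addr0 normrN.
Qed.

Lemma is_interval_norm_le_derive I f (f' : R -> R) (C a b : R) : is_interval I ->
  (forall z : R, I z -> is_derive z 1 f (f' z)) -> (forall z, I z -> `|f' z| <= C) ->
  I a -> I b -> `|f b - f a| <= C * `|b - a|.
Proof.
move=> iI df fC; wlog ab : a b / a < b => [H Ia Ib|Ia Ib].
  have [ab|ba|->] := ltgtP a b; first exact: H.
    by rewrite distrC [X in _ * X]distrC; exact: H.
  by rewrite !subrr normr0 mulr0.
have IS z : a <= z <= b -> I z by exact: iI.
have [c cab ->] : exists2 c, c \in `]a, b[%R & f b - f a = f' c * (b - a).
  apply: MVT => // [z|]; first by rewrite in_itv => /andP[/ltW az /ltW zb]; apply/df/IS/andP.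
  apply: derivable_within_continuous => z; rewrite in_itv => zab.
  by have [] := df z (IS _ zab).
rewrite normrM ler_wpM2r//; apply/fC/IS.
by move: cab; rewrite in_itv => /andP[/ltW -> /ltW ->].
Qed.

Lemma is_interval_derive0_cst I f (a b : R) : is_interval I ->
  (forall z : R, I z -> is_derive z 1 f 0) -> I a -> I b -> f a = f b.
Proof.
move=> iI df Ia Ib; apply/esym/eqP; rewrite -subr_eq0 -normr_le0.
rewrite -[leRHS](mul0r `|b - a|).
by apply: (@is_interval_norm_le_derive I _ (fun=> 0)) => // z _; rewrite normr0.
Qed.

(* Both iterated increments of phi over [t, s] x [x, y] are controlled by the
   oscillation of phi_tx, so phi_x inherits a t-derivative. *)
Lemma is_derive_dx_t I (phi : R -> R -> R) (t x : R) :
  open I -> regular_path I phi -> I t ->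
  is_derive t 1 (fun s => dx phi s x) (dx (dt phi) t x).
Proof.
move=> oI reg It; apply: is_derive_cvg; apply/cvgrPdist_le => e e0.
set A := dx (dt phi) t x.
have [_ _ _ /cvgrPdist_le/(_ _ e0) cA] := reg t x It.
have [d d0 Hd] : exists2 d : R, 0 < d & forall s y, ball t d s -> ball x d y ->
    I s /\ `|dx (dt phi) s y - A| <= e.
  have oI' : \forall p \near (t, x), I p.1.
    have c : p.1 @[p --> (t, x)] --> t by exact: cvg_fst.
    by apply: c; exact: open_nbhs_nbhs.
  have [d d0 Hd] := (@nbhs_ballP R (R * R)%type _ _).1 (filterI oI' cA).
  exists d => // s y ts xy; have [Is As] := Hd (s, y) (conj ts xy).
  by rewrite distrC.
have tt : ball t d t by exact: ballxx.
have xx : ball x d x by exact: ballxx.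
exists d => //= h; rewrite /ball_/= sub0r normrN => hd h0.
have th : ball t d (h + t) by rewrite /ball/= opprD addrCA subrr addr0 normrN.
have Ith : I (h + t) by have [] := Hd _ _ th xx.
have bI (z : R) : is_interval (ball z d).
  by rewrite ball_itv; exact: interval_is_interval.
have DD (y : R) : is_derive y 1 (fun y => phi (h + t) y - phi t y - h * A * y)
    (dx phi (h + t) y - dx phi t y - h * A).
  have D1 s : I s -> is_derive y 1 (phi s) (dx phi s y).
    by move=> Is; have [_ D _ _] := reg s y Is; exact: derivable_is_derive1.
  apply: is_deriveB; first by apply: is_deriveB; exact: D1.
  exact: is_derive_mull.
(* The mean value inequality is used twice: in space for phi_t - A y, giving e |y - x| at each time
   s, then in time, giving e |h| |y - x|. Letting y -> x with h fixed bounds phi_x(t + h, x) -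
   phi_x(t, x) - h A by e |h|. *)
have H y : ball x d y ->
    `|(phi (h + t) y - phi t y - h * A * y) - (phi (h + t) x - phi t x - h * A * x)|
    <= e * `|h| * `|y - x|.
  move=> xy.
  have Bk s : ball t d s -> `|(dt phi s y - A * y) - (dt phi s x - A * x)| <= e * `|y - x|.
    move=> ts; have [Is _] := Hd _ _ ts xx.
    apply: (is_interval_norm_le_derive (bI x)
      (f := fun y => dt phi s y - A * y) (f' := fun y => dx (dt phi) s y - A)) => // z xz.
      apply: is_deriveB.
        by have [_ _ D _] := reg s z Is; exact: derivable_is_derive1.
      exact: is_derive_mull.
    by have [] := Hd _ _ ts xz.
  have := is_interval_norm_le_derive (bI t)
    (f := fun s => phi s y - phi s x - s * (A * (y - x)))
    (f' := fun s => dt phi s y - dt phi s x - A * (y - x)) (C := e * `|y - x|) _ _ tt th.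
  rewrite addrK mulrAC; move=> H; apply: le_trans (H _ _).
  - by rewrite le_eqVlt; apply/orP; left; apply/eqP; congr Num.norm; ring.
  - move=> s ts; have [Is _] := Hd _ _ ts xx.
    have Dt z : is_derive s 1 (fun s => phi s z) (dt phi s z).
      by have [D _ _ _] := reg s z Is; exact: derivable_is_derive1.
    apply: is_deriveB; rewrite (_ : *%R^~ _ = *%R (A * (y - x))).
      exact: is_derive_mull.
    by apply/funext => z; rewrite mulrC.
  - move=> s ts; apply: le_trans (Bk s ts).
    by rewrite le_eqVlt; apply/orP; left; apply/eqP; congr Num.norm; ring.
have := is_derive_norm_le (DD x) (C := e * `|h|) _.
have -> : A - h^-1 *: (dx phi (h + t) x - dx phi t x) =
    - (h^-1 * (dx phi (h + t) x - dx phi t x - h * A)).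
  rewrite -[_ *: _]/(_ * _) !mulrBr mulKf// !opprB addrC; ring.
rewrite normrN normrM normfV ler_pdivrMl ?normr_gt0// [_ * e]mulrC; apply.
by exists d => //= y; exact: H.
Qed.

End calculus.

(** * Momentum *)

Section momentum.
Context {R : realType}.
Implicit Types (a d r x : R) (w : R -> R).

Lemma hs_momentum0 r : hs_momentum r 0 = 0 :> R.
Proof. by rewrite /hs_momentum mul0r. Qed.

Lemma hs_momentumN r a : hs_momentum r (- a) = - hs_momentum r a.
Proof. by rewrite /hs_momentum normrN mulNr. Qed.

Lemma gt0_hs_momentum r a : 0 < a -> hs_momentum r a = a `^ (r - 1).
Proof.
move=> a0; have -> : r - 1 = 1 + (r - 2) by ring.
by rewrite /hs_momentum gtr0_norm// [RHS]powRD ?(gt_eqF a0) ?implybT// powRr1// ltW.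
Qed.

(** The momentum is odd and equals a^(r-1) for a > 0, hence is homogeneous of degree r - 1 under
    positive factors. *)
Lemma powR_mul_hs_momentum r a x : 0 < a ->
  a `^ (r - 1) * hs_momentum r x = hs_momentum r (a * x).
Proof.
move=> a0; have a0' := ltW a0.
have [x0|x0|->] := ltgtP x 0; last by rewrite mulr0 !hs_momentum0 mulr0.
- rewrite -[x]opprK; move: (- x) (oppr_gt0 x) => y /[!x0] y0.
  rewrite mulrN !hs_momentumN mulrN; congr (- _).
  by rewrite !gt0_hs_momentum ?mulr_gt0// powRM// ltW.
- by rewrite !gt0_hs_momentum ?mulr_gt0// powRM// ltW.
Qed.

(** The absolute value |c|^(r-1) of the momentum determines |c|; for c nonzero the common factor
    |c|^(r-2) then cancels and leaves c with its sign. *)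
Lemma hs_momentum_inj r : 1 < r -> injective (@hs_momentum R r).
Proof.
move=> r1 a b ab.
have N c : `|hs_momentum r c| = `|c| `^ (r - 1).
  rewrite normrM (ger0_norm (powR_ge0 _ _)) (_ : r - 2 = r - 1 - 1); last by ring.
  by rewrite mulr_powRB1// subr_gt0.
have nab : `|a| = `|b|.
  have r0 : 0 < r - 1 by rewrite subr_gt0.
  by apply: (powR_injective r0); rewrite ?nnegrE// -!N ab.
have [a0|a0] := eqVneq a 0.
  by move: nab; rewrite a0 normr0 => /esym/normr0P/eqP.
move: ab; rewrite /hs_momentum nab; apply: mulIf.
by rewrite powR_eq0 normr_eq0 -normr_eq0 -nab normr_eq0 (negbTE a0).
Qed.

Lemma is_derive_hs_momentum r w (t d : R) : is_derive t 1 w d -> w t != 0 ->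
  is_derive t 1 (fun s => hs_momentum r (w s)) ((r - 1) * `|w t| `^ (r - 2) * d).
Proof.
have P w' (d' : R) : is_derive t 1 w' d' -> 0 < w' t ->
    is_derive t 1 (fun s => hs_momentum r (w' s)) ((r - 1) * `|w' t| `^ (r - 2) * d').
  move=> dw wt.
  have E : \forall s \near t, w' s `^ (r - 1) = hs_momentum r (w' s).
    apply: filterS (cvgr_gt _ (is_derive_continuous dw) _ wt) => s ws.
    by rewrite gt0_hs_momentum.
  apply: near_eq_is_derive E _; rewrite gtr0_norm// (_ : r - 2 = r - 1 - 1); last by ring.
  exact: is_derive_powR_comp.
move=> dw; case: (ltgtP (w t) 0) => // wt _; last exact: P.
have := P (fun s => - w s) (- d) _ _; rewrite normrN mulrN => H.
rewrite -[(fun s => _)]opprK -[X in is_derive _ _ _ X]opprK; apply: is_deriveN.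
rewrite (_ : - _ = fun s => hs_momentum r (- w s)).
  by apply: H; rewrite oppr_gt0.
by apply/funext => s; rewrite hs_momentumN.
Qed.

(** By the chain rule at w != 0, where |w|^r = |w|^(r-2) w^2, the quotient is exactly w_t + w^2 / r
    for every r > 1. *)
Lemma hs_lhs_limit (psi : R -> R -> R) (t x : R) :
  derivable (fun s => log_strain_rate psi s x) t 1 ->
  log_strain_rate psi t x != 0 ->
  hs_lhs r psi t x / (r * (r - 1) * `|log_strain_rate psi t x| `^ (r - 2))
    @[r --> +oo] --> dt (log_strain_rate psi) t x.
Proof.
move=> dw w0; set w := log_strain_rate psi t x in w0 *.
have E : \forall r \near +oo,
    dt (log_strain_rate psi) t x + w ^+ 2 / r =
    hs_lhs r psi t x / (r * (r - 1) * `|w| `^ (r - 2)).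
  near=> r; have r1 : 1 < r by near: r; apply: nbhs_pinfty_gt; rewrite num_real.
  have c0 : `|w| `^ (r - 2) != 0 by rewrite powR_eq0 normr_eq0 (negbTE w0).
  have H := is_derive_hs_momentum r (derivable_is_derive1 dw) w0.
  rewrite /hs_lhs [X in r * X + _](is_derive_derive1 H) -/w (_ : `|w| `^ r = `|w| `^ (r - 2) * w ^+ 2).
    rewrite /dt; field.
    by rewrite c0 subr_eq0 gt_eqF// gt_eqF// (lt_trans _ r1).
  rewrite -real_normK ?num_real// -powR_mulrn// -powRD ?normr_eq0 ?w0 ?implybT//.
  by congr (_ `^ _); ring.
have V0 : r^-1 @[r --> +oo] --> (0 : R).
  by apply/gtr0_cvgV0; [exact: nbhs_pinfty_gt|exact: cvg_id].
have L : dt (log_strain_rate psi) t x + w ^+ 2 / r @[r --> +oo] -->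
    dt (log_strain_rate psi) t x + w ^+ 2 * 0.
  by apply: cvgD; [exact: cvg_cst|apply: cvgM; [exact: cvg_cst|exact: V0]].
rewrite mulr0 addr0 in L.
exact: cvg_trans (near_eq_cvg E) L.
Unshelve. all: by end_near. Qed.

End momentum.

(** * Solutions of the r-Hunter--Saxton equation *)

(** The difference of the two sides has zero derivative and tends to 0 at -oo. *)
Lemma vanishing_primitive (R : realType) (f : R -> R) (x : R) :
  (forall x, derivable f x 1) -> csobolev1 0 (derive1 f) -> vanishing_left_infty f ->
  f x = \int[@lebesgue_measure R]_(y in `]-oo, x]) derive1 f y.
Proof.
move=> df [[intf cf _] _] f0.
pose F z := \int[@lebesgue_measure R]_(y in `]-oo, z]) derive1 f y.
pose D := fun z => f z - F z.
have Dcst z : D z = D 0.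
  apply: (@is_interval_derive0_cst _ setT) => // y _.
  rewrite -(subrr (derive1 f y)); apply: is_deriveB; first exact: derivable_is_derive1.
  exact (is_derive_integral_itvNy intf (cf y)).
have D0 : D z @[z --> -oo] --> (0 : R).
  by rewrite -(subrr 0); apply: cvgB f0 _; exact: integral_itvNy_vanishing.
have : D 0 = 0.
  apply: (@cvg_unique _ _ (D z @[z --> -oo])) => //.
  by rewrite (_ : D = cst (D 0)); [exact: cvg_cst|apply/funext].
by rewrite -(Dcst x) => /subr0_eq.
Qed.

Definition power_density {R : realType} (r : R) (u0 : R -> R) (t x : R) : R :=
  (1 + t / r * derive1 u0 x) `^ r - 1.

Lemma hs_momentum_mul (R : realType) (r w : R) : 1 < r ->
  hs_momentum r w * w = `|w| `^ r.
Proof.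
move=> r1; rewrite /hs_momentum mulrAC -expr2 -real_normK ?num_real// expr2 -mulrA.
rewrite (_ : r - 2 = r - 1 - 1); last by ring.
by rewrite !mulr_powRB1// ?subr_gt0// (lt_trans ltr01).
Qed.

(* phi_x^((r-1)/r) w |w|^(r-2), with w = phi_tx/phi_x, is conserved; it is the
   momentum of phi_x^(1/r) w, so (phi_x^(1/r))_t = phi_x^(1/r) w / r is constant
   in time. *)
Lemma hs_solution_dx (R : realType) (r : R) (u0 : R -> R) (I : set R)
    (phi : R -> R -> R) (t x : R) :
  1 < r -> hs_solution r u0 I phi -> I t ->
  dx phi t x = (1 + t / r * derive1 u0 x) `^ r.
Proof.
move=> r1 [[iI oI I0] Dphi reg [phi0 dphi0] eqn] It.
have r0 : 0 < r by rewrite (lt_trans ltr01).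
have rn0 : r != 0 by rewrite gt_eqF.
pose P s := dx phi s x; pose w s := log_strain_rate phi s x.
pose m s := hs_momentum r (w s).
have P0 s : I s -> 0 < P s.
  move=> /Dphi[f fE [df _ f1 _]].
  have d : is_derive x 1 (phi s) (1 + derive1 f x).
    by rewrite fE; apply: is_deriveD; exact: derivable_is_derive1.
  by rewrite /P /dx (is_derive_derive1 d) -ltrBlDl sub0r f1.
have dP s : I s -> is_derive s 1 P (w s * P s).
  move=> Is; have := is_derive_dx_t x oI reg Is; congr is_derive.
  by rewrite /w /log_strain_rate divfK// gt_eqF// P0.
have dm s : I s -> is_derive s 1 m (- ((r - 1) / r * `|w s| `^ r)).
  move=> /(eqn _ x)[dms].
  rewrite /hs_lhs -/(w s) /(dt _) -/m => e.
  have := derivable_is_derive1 dms; congr is_derive.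
  by apply: (mulfI rn0); move/eqP: e; rewrite addr_eq0 => /eqP ->; field.
pose a := (r - 1) / r.
have a0 : 0 < a by rewrite divr_gt0// subr_gt0.
have N s : I s -> P s `^ a * m s = m 0.
  have P00 : P 0 = 1.
    by rewrite /P /dx (_ : phi 0 = id); [exact: derive1_id|apply/funext].
  move=> Is; have <- : P 0 `^ a * m 0 = m 0 by rewrite P00 powR1 mul1r.
  apply: (is_interval_derive0_cst (f := fun s => P s `^ a * m s) iI) => // z Iz.
  (* Since P_t = w P, the product rule gives a P^a (m w - |w|^r), and m w = |w|^r. *)
  rewrite (_ : 0 = P z `^ a *: (- (a * `|w z| `^ r)) +
      m z *: (a * P z `^ (a - 1) * (w z * P z))).
    by apply: is_deriveM; [apply: is_derive_powR_comp; [exact: P0|exact: dP]|exact: dm].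
  rewrite /GRing.scale/= -(hs_momentum_mul (w z) r1) -/(m z).
  by rewrite -(@mulr_powRB1 _ (P z) a) ?ltW ?P0//; ring.
have w0 : w 0 = derive1 u0 x.
  rewrite /w /log_strain_rate {1}/dx (_ : dt phi 0 = u0); last exact/funext.
  by rewrite /dx (_ : phi 0 = id) ?derive1_id ?divr1//; apply/funext.
pose Y s := P s `^ r^-1.
have Yw s : I s -> Y s * w s = derive1 u0 x.
  (* As a = (r - 1) / r, P^a = Y^(r-1); by homogeneity [N] says that Y w and w 0 have the same
     momentum. *)
  move=> Is; rewrite -w0; apply: (hs_momentum_inj r1).
  rewrite -powR_mul_hs_momentum ?powR_gt0 ?P0// -powRrM [_^-1 * _]mulrC.
  exact: N.
have dY s : I s -> is_derive s 1 Y (derive1 u0 x / r).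
  move=> Is; have := is_derive_powR_comp r^-1 (P0 _ Is) (dP _ Is).
  congr is_derive; rewrite -(Yw _ Is) /Y.
  by rewrite -(@mulr_powRB1 _ (P s) r^-1) ?invr_gt0 ?ltW ?P0//; ring.
have Yt : Y t = 1 + t / r * derive1 u0 x.
  have Y0 : Y 0 = 1.
    by rewrite /Y /P /dx (_ : phi 0 = id) ?derive1_id ?powR1//; apply/funext.
  have e : Y t - derive1 u0 x / r * t = 1.
    rewrite -Y0 -[RHS]subr0 -[X in _ = _ - X](mulr0 (derive1 u0 x / r)).
    apply: (is_interval_derive0_cst (f := fun s => Y s - derive1 u0 x / r * s) iI) => //.
    move=> z Iz; rewrite -(subrr (derive1 u0 x / r)).
    by apply: is_deriveB; [exact: dY|exact: is_derive_mull].
  by rewrite -[Y t](subrK (derive1 u0 x / r * t)) e; ring.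
by rewrite -Yt /Y -powRrM mulVf// powRr1// ltW// P0.
Qed.

(** An element of Diff_{-oo} is determined by its spatial derivative, as its displacement vanishes
    at -oo. The interval is arbitrary, so this uniqueness applies on all of [hs_lifespan]. *)
Lemma hs_solution_flow (R : realType) (r : R) (u0 : R -> R) (I : set R)
    (phi : R -> R -> R) (t x : R) :
  1 < r -> hs_solution r u0 I phi -> I t ->
  phi t x = flow (power_density r u0) t x.
Proof.
move=> r1 hphi It; have [_ Dphi _ _ _] := hphi.
have [f fE [df fS _ f0]] := Dphi _ It.
rewrite fE /flow (vanishing_primitive x df (sobolev1_infty_csobolev1 0 fS) f0).
congr (_ + _); apply: eq_Rintegral => y _.
rewrite /power_density -(hs_solution_dx y r1 hphi It).
have d : is_derive y 1 (phi t) (1 + derive1 f y).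
  by rewrite fE; apply: is_deriveD; exact: derivable_is_derive1.
by rewrite /dx (is_derive_derive1 d) addrC addKr.
Qed.

(** * Existence of the explicit solutions and their limit *)

Section hunter_saxton.
Context {R : realType}.
Variables (u0 : R -> R) (M : R).
Hypotheses (hu0 : g_minus_infty u0) (M0 : 0 < M).
Hypothesis (u0M : forall x, `|derive1 u0 x| <= M).
Local Notation v := (derive1 u0).
Notation mu := (@lebesgue_measure R).

Let vS k : csobolev1 k v.
Proof. by have [_ vS _] := hu0; exact: sobolev1_infty_csobolev1. Qed.

Let iv : mu.-integrable setT (EFin \o v).
Proof. by have [] := csobolev1_0 (vS 0). Qed.

Let cv : continuous v.
Proof. by have [] := csobolev1_0 (vS 0). Qed.

Let cvp : continuous (fun p : R * R => v p.2).
Proof. by move=> p; apply: continuous_comp; [exact: cvg_snd|exact: cv]. Qed.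

Section power.
Variable r : R.
Hypothesis r1 : 1 < r.
Let r0 : 0 < r. Proof. exact: lt_trans ltr01 r1. Qed.
Let rho := r / (2 * M).

Let small t : `|t| < rho -> `|t / r| * M <= 2^-1.
Proof.
rewrite /rho ltr_pdivlMr ?mulr_gt0// normf_div (gtr0_norm r0) => tr.
by rewrite mulrAC ler_pdivrMr//; lra.
Qed.

Let base0 t x : `|t| < rho -> 0 < 1 + t / r * v x.
Proof. by move=> /small; exact: base_gt0. Qed.

Let h (t x : R) := v x * (1 + t / r * v x) `^ (r - 1).
(** For |t| < rho the base 1 + t v / r is at most 3/2, and the exponent r - 1 is positive. *)
Let G x := (3 / 2) `^ (r - 1) * `|v x|.

Let ig t : `|t| < rho -> mu.-integrable setT (EFin \o power_density r u0 t).
Proof. by move=> tr; have [] := csobolev1_0 (csobolev1_powR vS u0M 0 r (small tr)). Qed.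

Let cg t : `|t| < rho -> continuous (power_density r u0 t).
Proof. by move=> tr; have [] := csobolev1_0 (csobolev1_powR vS u0M 0 r (small tr)). Qed.

Let gh (t x : R) : `|t| < rho -> is_derive t 1 (power_density r u0 ^~ x) (h t x).
Proof.
move=> tr; rewrite /h /power_density [X in is_derive _ _ _ X](_ : _ =
    r * (1 + t / r * v x) `^ (r - 1) * (v x / r) - 0).
  apply: is_deriveB; apply: is_derive_powR_comp; first exact: base0.
  rewrite -[v x / r]add0r; apply: is_deriveD.
  rewrite (_ : (fun _ => _) = *%R (v x / r)); first exact: is_derive_mull.
  by apply/funext => s; rewrite mulrC mulrA mulrAC.
by field; rewrite gt_eqF.
Qed.

Let hG t x : `|t| < rho -> `|h t x| <= G x.
Proof.
move=> tr; rewrite normrM mulrC ler_wpM2r// ger0_norm ?powR_ge0//.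
have := base_bounds u0M x (small tr); rewrite ler_norml => /andP[b1 b2].
have r10 : 0 <= r - 1 by rewrite subr_ge0 ltW.
by apply: ge0_ler_powR => //; rewrite ?nnegrE; lra.
Qed.

Let iG : mu.-integrable setT (EFin \o G).
Proof.
apply: (@integrable_le_norm _ _ v ((3 / 2) `^ (r - 1))) => // x.
  by apply: cvgM; [exact: cvg_cst|apply: cvg_norm; exact: cv].
by rewrite normrM normr_id ger0_norm ?powR_ge0.
Qed.

Let ch (t x : R) : `|t| < rho -> {for (t, x), continuous (fun p : R * R => h p.1 p.2)}.
Proof.
move=> tr; apply: cvgM; first exact: cvp.
have cb : 1 + p.1 / r * v p.2 @[p --> (t, x)] --> 1 + t / r * v x.
  have c1 : p.1 @[p --> (t, x)] --> t by exact: cvg_fst.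
  have c2 : v p.2 @[p --> (t, x)] --> v x by exact: (cvp (x := (t, x))).
  apply: cvgD; first exact: cvg_cst.
  by apply: cvgM c2; apply: cvgM c1 _; exact: cvg_cst.
have := is_derive_powR_comp (g := id) (r - 1) (base0 x tr) (is_derive_id _ _).
by move=> /is_derive_continuous cp; exact: (cvg_comp _ _ cb cp).
Qed.

(** Here w = v / (1 + t v / r), so w_t = - w^2 / r and the momentum has time derivative - ((r - 1) /
    r) |w|^r, which is the equation. *)
Lemma power_flow_solution :
  hs_solution r u0 [set t | `|t| < rho] (flow (power_density r u0)).
Proof.
have rho0 : 0 < rho by rewrite divr_gt0// mulr_gt0.
have IE : [set t | `|t| < rho] = ball (0 : R) rho.
  by apply/seteqP; split=> t; rewrite /ball/= sub0r normrN.
split.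
- split.
  + by rewrite IE ball_itv; exact: interval_is_interval.
  + by rewrite IE; exact: ball_open.
  + by rewrite /= normr0.
- move=> t tr; apply: flow_Diff => [k|x].
    exact: (csobolev1_powR vS u0M k r (small tr)).
  by rewrite ltrBrDl subrr powR_gt0// base0.
- exact (flow_regular ig cg gh hG iG ch).
- have r00 : `|0 : R| < rho by rewrite normr0.
  split=> x.
    rewrite /flow (_ : \int[mu]_(y in _) _ = 0) ?addr0//.
    rewrite -[RHS](mul0r (fine (mu `]-oo, x]))) -Rintegral_cst//.
    by apply: eq_Rintegral => y _; rewrite /power_density !mul0r addr0 powR1 subrr.
  rewrite (dt_flow ig gh hG iG r00).
  have [du0 _ u00] := hu0; rewrite (vanishing_primitive _ du0 (vS 0) u00).
  by apply: eq_Rintegral => y _; rewrite /h !mul0r addr0 powR1 mulr1.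
- move=> t x tr.
  pose w s := v x / (1 + s / r * v x).
  have wE s : `|s| < rho -> log_strain_rate (flow (power_density r u0)) s x = w s.
    move=> sr; rewrite (log_strain_rate_flow ig cg gh hG iG ch _ sr).
    rewrite /h /power_density subrKC /w.
    have b0 := base0 x sr.
    rewrite -(@mulr_powRB1 _ _ r) ?ltW// invfM mulrACA divff ?mulr1//.
    by rewrite gt_eqF// powR_gt0.
  have nE : \forall s \near t, hs_momentum r (w s) =
      hs_momentum r (log_strain_rate (flow (power_density r u0)) s x).
    have c : `|s| @[s --> t] --> `|t| by apply: cvg_norm; exact: cvg_id.
    by apply: filterS (cvgr_lt _ c _ tr) => s sr; rewrite wE.
  have H : is_derive t 1 (fun s => hs_momentum r (w s)) (- ((r - 1) / r * `|w t| `^ r)).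
    (* The chain rule for the momentum requires w != 0. Where v x = 0, w vanishes at all times and
       the momentum is constantly 0. *)
    have [vx0|vx0] := eqVneq (v x) 0.
      rewrite (_ : (fun _ => _) = cst 0); last first.
        by apply/funext => s; rewrite /w vx0 mul0r hs_momentum0.
      by rewrite /w vx0 mul0r normr0 powR0 ?gt_eqF// mulr0 oppr0; exact: is_derive_cst.
    have b0 := base0 x tr.
    have wt0 : w t != 0 by rewrite mulf_neq0// invr_eq0 gt_eqF.
    have dw : is_derive t 1 w (- (w t ^+ 2 / r)).
      have db : is_derive t 1 (fun s => 1 + s / r * v x) (v x / r).
        rewrite -[v x / r]add0r; apply: is_deriveD.
        rewrite (_ : (fun _ => _) = *%R (v x / r)); first exact: is_derive_mull.
        by apply/funext => s; rewrite mulrC mulrA mulrAC.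
      have bn0 : 1 + t / r * v x != 0 by rewrite gt_eqF.
      have -> : - (w t ^+ 2 / r) = v x *: (- (1 + t / r * v x) ^- 2 *: (v x / r)).
        rewrite /w /GRing.scale/=; move: bn0; move: (1 + t / r * v x) => B Bn0.
        by field; rewrite Bn0 gt_eqF.
      by apply: is_deriveZ; exact: is_deriveV.
    have := is_derive_hs_momentum r dw wt0; congr is_derive.
    rewrite (_ : `|w t| `^ r = `|w t| `^ (r - 2) * w t ^+ 2); first by field; rewrite gt_eqF.
    rewrite -real_normK ?num_real// -powR_mulrn// -powRD ?normr_eq0 ?wt0 ?implybT//.
    by congr (_ `^ _); ring.
  have H' := near_eq_is_derive nE H.
  split; first by have [] := H'.
  rewrite /hs_lhs [X in r * X + _](is_derive_derive1 H') wE//.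
  by field; rewrite gt_eqF.
Qed.

End power.

(** In w the factor e^(tv) cancels, leaving v. The dominating function e^(rho M) |v| confines time
    to a bounded interval, but rho is arbitrary, so every t is reached. *)
Lemma phi_infty_regular (rho : R) : 0 < rho ->
  regular_path [set t | `|t| < rho] (phi_infty u0) /\
  forall t x, `|t| < rho -> log_strain_rate (phi_infty u0) t x = v x.
Proof.
move=> rho0.
pose g t x := expR (t * v x) - 1; pose h t x := v x * expR (t * v x).
pose G x := expR (rho * M) * `|v x|.
have gS t k : csobolev1 k (g t) by exact: (csobolev1_exp vS u0M).
have ig t : `|t| < rho -> mu.-integrable setT (EFin \o g t).
  by have [] := csobolev1_0 (gS t 0).
have cg t : `|t| < rho -> continuous (g t) by have [] := csobolev1_0 (gS t 0).
have gh (t x : R) : `|t| < rho -> is_derive t 1 (g ^~ x) (h t x).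
  move=> _; rewrite /h /g [X in is_derive _ _ _ X](_ : _ = expR (t * v x) * v x - 0).
    apply: is_deriveB; apply: is_derive_expR_comp.
    rewrite (_ : *%R^~ _ = *%R (v x)); first exact: is_derive_mull.
    by apply/funext => s; rewrite mulrC.
  by rewrite subr0 mulrC.
have hG t x : `|t| < rho -> `|h t x| <= G x.
  move=> tr; rewrite normrM mulrC ler_wpM2r// ger0_norm ?expR_ge0// ler_expR.
  by rewrite (le_trans (ler_norm _))// normrM ler_pM// ltW.
have iG : mu.-integrable setT (EFin \o G).
  apply: (@integrable_le_norm _ _ v (expR (rho * M))) => // x.
    by apply: cvgM; [exact: cvg_cst|apply: cvg_norm; exact: cv].
  by rewrite normrM normr_id ger0_norm ?expR_ge0.
have ch (t x : R) : `|t| < rho -> {for (t, x), continuous (fun p : R * R => h p.1 p.2)}.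
  move=> tr; apply: cvgM; first exact: cvp.
  have ce : p.1 * v p.2 @[p --> (t, x)] --> t * v x.
    have c1 : p.1 @[p --> (t, x)] --> t by exact: cvg_fst.
    have c2 : v p.2 @[p --> (t, x)] --> v x by exact: (cvp (x := (t, x))).
    exact: cvgM c1 c2.
  exact: (cvg_comp _ _ ce (@continuous_expR R (t * v x))).
split=> [|t x tr]; first exact (flow_regular ig cg gh hG iG ch).
have := log_strain_rate_flow ig cg gh hG iG ch x tr.
by rewrite -[flow g]/(phi_infty u0) => ->; rewrite /g subrKC mulfK// gt_eqF ?expR_gt0.
Qed.

Lemma phi_infty_Diff t : Diff_minus_infty (phi_infty u0 t).
Proof.
apply: (@flow_Diff _ (fun t x => expR (t * v x) - 1)) => [k|x].
  exact: (csobolev1_exp vS u0M).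
by rewrite ltrBrDl subrr expR_gt0.
Qed.

Lemma power_flow_cvg (t x : R) :
  flow (power_density r u0) t x @[r --> +oo] --> phi_infty u0 t x.
Proof.
(* With z = t v, the error e^z 2 z^2 / r is at most (K / r) |v|: one factor |v| of z^2 is bounded by
   M, the other is kept for integrability. Then r > K V / e makes the integrated error at most e. *)
pose K := expR (`|t| * M) * (2 * (`|t| ^+ 2 * M)).
pose V := \int[mu]_(y in `]-oo, x]) `|v y|.
have ivx : mu.-integrable `]-oo, x] (EFin \o (fun y => `|v y|)).
  by apply: integrableS (integrable_norm iv).
apply/cvgrPdist_le => e e0; near=> r.
have r1 : 1 < r by near: r; apply: nbhs_pinfty_gt; rewrite num_real.
have r0 : 0 < r by rewrite (lt_trans ltr01).
have rt : `|t| * (2 * M) < r by near: r; apply: nbhs_pinfty_gt; rewrite num_real.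
have re : K * V / e < r by near: r; apply: nbhs_pinfty_gt; rewrite num_real.
have tM : `|t / r| * M <= 2^-1.
  by rewrite normf_div (gtr0_norm r0) mulrAC ler_pdivrMr//; lra.
have i1 : mu.-integrable `]-oo, x] (EFin \o (fun y => expR (t * v y) - 1)).
  have [i1 _ _] := csobolev1_0 (csobolev1_exp vS u0M 0 t).
  by apply: integrableS i1.
have i2 : mu.-integrable `]-oo, x] (EFin \o power_density r u0 t).
  have [i2 _ _] := csobolev1_0 (csobolev1_powR vS u0M 0 r tM).
  by apply: integrableS i2.
have i3 : mu.-integrable `]-oo, x] (EFin \o
    (fun y => expR (t * v y) - 1 - power_density r u0 t y)).
  rewrite (_ : _ \o _ = fun y => (expR (t * v y) - 1)%:E - (power_density r u0 t y)%:E)%E.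
    exact: integrableB.
  by apply/funext => y /=; rewrite EFinB.
have i4 : mu.-integrable `]-oo, x] (EFin \o (fun y => K / r * `|v y|)).
  rewrite (_ : _ \o _ = fun y => (K / r)%:E * (`|v y|)%:E)%E; first exact: integrableZl.
  by apply/funext => y /=; rewrite EFinM.
rewrite /phi_infty /flow opprD addrACA subrr add0r -RintegralB//.
apply: le_trans (le_normr_Rintegral _ _) _ => //.
apply: (@le_trans _ _ (\int[mu]_(y in `]-oo, x]) (K / r * `|v y|))).
  apply: le_Rintegral => //; first exact: (integrable_norm i3).
  move=> y _; rewrite /power_density opprB addrA subrK.
  have z2 : `|t * v y| <= `|t| * M by rewrite normrM ler_wpM2l.
  have zr : `|t * v y| <= r / 2 by rewrite (le_trans z2)// ler_pdivlMr//; lra.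
  rewrite distrC [t / r * _]mulrAC (le_trans (powR_1Dr_expR r0 zr))//.
  have -> : K / r * `|v y| = expR (`|t| * M) * (2 * (`|t| ^+ 2 * M) / r * `|v y|).
    by rewrite /K !mulrA.
  apply: ler_pM; rewrite ?expR_ge0//.
  - by apply: divr_ge0; [rewrite mulr_ge0 ?sqr_ge0|exact: ltW].
  - by rewrite ler_expR (le_trans (ler_norm _)).
  - rewrite [leRHS]mulrAC ler_wpM2r ?invr_ge0 ?(ltW r0)// -mulrA ler_wpM2l//.
    have -> : (t * v y) ^+ 2 = `|t| ^+ 2 * `|v y| ^+ 2.
      by rewrite -exprMn -normrM real_normK ?num_real.
    rewrite -[leRHS]mulrA ler_wpM2l ?exprn_ge0//.
    by rewrite expr2 ler_wpM2r.
rewrite RintegralZl// -/V mulrAC ler_pdivrMr//.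
by rewrite -ler_pdivrMl// mulrC ltW.
Unshelve. all: by end_near. Qed.

End hunter_saxton.

Unset Implicit Arguments.

Theorem theorem2p8p1 (R : realType) (u0 : R -> R) (phi : R -> R -> R -> R)
    (hu0 : g_minus_infty u0)
    (hphi : forall r : R, 1 < r -> hs_solution r u0 (hs_lifespan r u0) (phi r)) :
  (* the pointwise limit, for all t *)
  (forall t : R,
     (\forall r \near +oo, hs_lifespan r u0 t) /\
     forall x : R,
       (@lebesgue_measure R).-integrable `]-oo, x]
         (fun y => (expR (t * derive1 u0 y) - 1)%:E) /\
       phi r t x @[r --> +oo] --> phi_infty u0 t x) /\
  (* the limit lies in Diff_{-oo}(R) and satisfies (phi_tx / phi_x)_t = 0 *)
  (forall t : R, Diff_minus_infty (phi_infty u0 t)) /\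
  regular_path setT (phi_infty u0) /\
  (forall t x : R,
     derivable (fun s => log_strain_rate (phi_infty u0) s x) t 1 /\
     dt (log_strain_rate (phi_infty u0)) t x = 0) /\
  (* the formal limit: dividing the r-equation by the factor
     r (r - 1) |w|^(r - 2), w = phi_tx / phi_x, which is nonzero where w is,
     its left-hand side tends to w_t *)
  (forall (psi : R -> R -> R) (t x : R),
     derivable (fun s => log_strain_rate psi s x) t 1 ->
     log_strain_rate psi t x != 0 ->
     hs_lhs r psi t x /
       (r * (r - 1) * `|log_strain_rate psi t x| `^ (r - 2))
       @[r --> +oo] --> dt (log_strain_rate psi) t x).
Proof.
have [M M0 u0M] : exists2 M : R, 0 < M & forall x, `|derive1 u0 x| <= M.
  have [_ /(sobolev1_infty_csobolev1 0)/csobolev1_0[_ _ [M u0M]] _] := hu0.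
  exists (`|M| + 1) => [|x]; first by rewrite ltr_wpDl.
  by rewrite (le_trans (u0M x))// ler_wpDr// ler_norm.
have life t : \forall r \near +oo, 1 < r /\ hs_lifespan r u0 t.
  near=> r.
  have r1 : 1 < r by near: r; apply: nbhs_pinfty_gt; rewrite num_real.
  have rt : `|t| * (2 * M) < r by near: r; apply: nbhs_pinfty_gt; rewrite num_real.
  (* By definition of the lifespan, any solution on an interval containing t will do; r > 2 M |t|
     places t in the interval of the explicit one. *)
  split=> //; exists [set s | `|s| < r / (2 * M)], (flow (power_density r u0)).
  split; first exact: power_flow_solution.
  by rewrite /= ltr_pdivlMr// mulr_gt0.
have reg (t : R) := phi_infty_regular hu0 u0M (ltr_wpDl (normr_ge0 t) ltr01).
have lt1 (t : R) : `|t| < `|t| + 1 by rewrite ltrDl.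
split=> [t|].
  split=> [|x]; first by apply: filterS (life t) => r [].
  split.
    have [_ u0S _] := hu0.
    have [i1 _ _] := csobolev1_0
      (csobolev1_exp (fun k => sobolev1_infty_csobolev1 k u0S) u0M 0 t).
    by apply: integrableS i1.
  (* For large r the time t lies in the lifespan, where uniqueness identifies [phi r] with the
     explicit flow. *)
  apply: cvg_trans (@power_flow_cvg _ _ _ hu0 u0M t x).
  apply: near_eq_cvg; apply: filterS (life t) => r [r1 tr].
  by rewrite (hs_solution_flow x r1 (hphi r r1) tr).
split; first by move=> t; exact: (phi_infty_Diff hu0 u0M t).
split; first by move=> t x _; exact: (reg t).1 t x (lt1 t).
split=> [t x|]; last exact: hs_lhs_limit.
have E : \forall s \near t, derive1 u0 x = log_strain_rate (phi_infty u0) s x.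
  have c : `|s| @[s --> t] --> `|t| by apply: cvg_norm; exact: cvg_id.
  by apply: filterS (cvgr_lt _ c _ (lt1 t)) => s st; rewrite (reg t).2.
have D := near_eq_is_derive E (is_derive_cst (derive1 u0 x) t 1).
by split; [have [] := D|exact: is_derive_derive1 D].
Unshelve. all: by end_near. Qed.
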